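(* Let $T$ be any rooted, infinite, locally finite tree, with branching number $\operatorname{br}T$. For any $\theta\in[0,1]$ with $\theta<\frac{1}{e\operatorname{br}T}$, \[\mathbb{P}(\text{there exists an infinite increasing path started from the root})=0.\] In particular, $\theta_c(T)\ge\frac{1}{e\operatorname{br}T}$.
   Context: Rough Mount Fuji labels: let $V$ be the vertex set of $T$, $\rho$ its root, $d$ the graph distance, and $\theta\in[0,1]$. Let $\{U_v:v\in V\}$ be i.i.d. Uniform$(0,1)$ and set $X_v=U_v+\theta\,d(\rho,v)$. A simple path $\rho=v_0,v_1,v_2,\ldots$ is increasing if $X_{v_0}<X_{v_1}<\cdots$. The critical value is $\theta_c(T)=\inf\{\theta\in[0,1]:\mathbb{P}(\text{there is an infinite increasing path from }\rho)>0\}$. A cutset separating $\rho$ from infinity is a set $\Pi\subset V\setminus\{\rho\}$ such that every infinite simple path from $\rho$ includes at least one vertex of $\Pi$. The branching number is \[\operatorname{br}T=\sup\Bigl\{\lambda>0:\inf_\Pi\sum_{v\in\Pi}\lambda^{-d(\rho,v)}>0\Bigr\},\] where the infimum is over cutsets $\Pi$ separating $\rho$ from infinity. (One always has $\operatorname{br}T\ge1$; if $\operatorname{br}T=\infty$, interpret $\frac{1}{e\operatorname{br}T}$ as $0$.) *)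

(* Defs.v *)
From HB Require Import structures.
From mathcomp Require Import all_boot all_order all_algebra finmap.
From mathcomp Require Import all_classical all_reals all_analysis.

Set Implicit Arguments.
Unset Strict Implicit.
Unset Printing Implicit Defensive.
Import Order.TTheory GRing.Theory Num.Theory.
Import numFieldNormedType.Exports.
Local Open Scope classical_set_scope.
Local Open Scope ring_scope.

Record rooted_tree := RootedTree {
  vertex : choiceType;
  adj : rel vertex;
  root : vertex;
  adj_sym : symmetric adj;
  adj_irrefl : irreflexive adj;
  tree_connected : forall x y : vertex,
    exists2 p : seq vertex, path adj x p & last x p = y;
  tree_acyclic : forall c : seq vertex,
    (2 < size c)%N -> ~ ucycle adj c }.

Arguments adj {r}.
Arguments root {r}.

Definition locally_finite (T : rooted_tree) :=
  forall v : vertex T, finite_set [set u | adj v u].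

Definition is_walk_length (T : rooted_tree) (x y : vertex T) (n : nat) :=
  exists p : seq (vertex T), [/\ path adj x p, last x p = y & size p = n].

Lemma ex_walk_length (T : rooted_tree) (x y : vertex T) :
  exists n, `[< is_walk_length x y n >].
Proof.
by have [p xp py] := tree_connected x y; exists (size p); apply/asboolP; exists p.
Qed.

Definition gdist (T : rooted_tree) (x y : vertex T) : nat :=
  ex_minn (ex_walk_length x y).

Definition infinite_path (T : rooted_tree) (f : nat -> vertex T) :=
  [/\ f 0%N = root, forall n, adj (f n) (f n.+1) & injective f].

Definition cutset (T : rooted_tree) (Pi : set (vertex T)) :=
  ~ Pi root /\ forall f, infinite_path f -> exists n, Pi (f n).

Definition cutset_sum (R : realType) (T : rooted_tree) (lambda : R)
    (Pi : set (vertex T)) : \bar R :=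
  \esum_(v in Pi) (lambda ^- gdist root v)%:E.

Definition branching_number (R : realType) (T : rooted_tree) : \bar R :=
  ereal_sup [set lambda%:E | lambda in [set lambda : R | 0 < lambda /\
    (0 < ereal_inf [set cutset_sum lambda Pi | Pi in @cutset T])%E]].

Section labels.
Context (R : realType) (d : measure_display) (Omega : measurableType d).
Context (P : probability Omega R).

(* The product rule is only required of finite subfamilies, which is mutual
   independence of the whole family. *)
Definition mutually_independent (I : choiceType) (U : I -> {RV P >-> R}) :=
  forall (F : {fset I}) (A : I -> set R), (forall i, measurable (A i)) ->
    P (\bigcap_(i in [set` F]) (U i @^-1` A i)) =
    (\prod_(i <- F) P (U i @^-1` A i))%E.

Definition iid_uniform01 (I : choiceType) (U : I -> {RV P >-> R}) :=
  (forall i (A : set R), measurable A ->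
     distribution P (U i) A = uniform_prob (@ltr01 R) A) /\
  mutually_independent U.

Context (T : rooted_tree) (U : vertex T -> {RV P >-> R}).

Definition rmf_label (theta : R) (v : vertex T) (w : Omega) : R :=
  U v w + theta * (gdist root v)%:R.

(* In a locally finite tree this event is measurable: by Koenig's lemma it is
   the intersection over n of the events that some increasing path of length n
   starts at the root, each a finite union of measurable events. *)
Definition increasing_path_event (theta : R) : set Omega :=
  [set w | exists f : nat -> vertex T, infinite_path f /\
    forall n, rmf_label theta (f n) w < rmf_label theta (f n.+1) w].

Definition theta_c : \bar R :=
  ereal_inf [set theta%:E | theta in [set theta : R |
    0 <= theta <= 1 /\ (0 < P (increasing_path_event theta))%E]].

End labels.

(* Main.v *)
Require Import Defs.
From mathcomp Require Import all_boot all_order all_algebra finmap.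
From mathcomp Require Import all_classical all_reals all_analysis.
From mathcomp Require Import measurable_realfun ring lra zify.
Set Implicit Arguments.
Unset Strict Implicit.
Unset Printing Implicit Defensive.
Import Order.TTheory GRing.Theory Num.Theory.
Import numFieldNormedType.Exports.
Local Open Scope classical_set_scope.
Local Open Scope ring_scope.

(** The proof is a first-moment bound over a cutset.

    Let v be a vertex at distance n from the root.  If the labels increase
    along the path from the root to v, then they form an increasing sequence
    of m = n + 1 numbers in [0, L], where L = 1 + theta * m.  Each label is
    uniform on an interval of length 1, so its density is at most 1, and by
    independence the probability of this event is at most the volume of the
    simplex of increasing m-tuples in [0, L], which is L^m / m!
    ([prob_increasing_le]).  Writing L = theta * x with x = m + 1 / theta, the
    bound x^m / m! <= exp x turns this into exp (1 / theta) * (e * theta)^m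
    ([prob_increasing_le_exp]).

    The volume bound uses nothing but the product rule for independent events.
    Cut [0, L] into N equal cells.  The cells of an increasing sequence of
    labels form a weakly increasing sequence; there are 'C(m + N - 1, m) of
    those, and each occurs with probability at most (L / N)^m
    ([prob_increasing_le_cells]).  Then let N go to infinity.

    In a tree, an infinite path reaches each of its vertices by the unique
    simple path from the root ([simple_path_unique]).  An infinite increasing
    path must meet every cutset Pi, so its existence has probability at most a
    constant times the sum over v in Pi of (e * theta)^(d v), that is, the
    cutset sum of Pi at lambda = 1 / (e * theta)
    ([prob_increasing_path_le_cutset]).  When theta < 1 / (e * br T) this lambda
    exceeds br T, so the infimum of the cutset sums is 0 and so is the
    probability.  As the constant blows up when theta tends to 0, the bounds are
    used with a larger slope that is positive and still below 1 / (e * br T)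
    ([slope_above_branching_number]); this covers theta = 0.

    The event must also be shown to be measurable, as a measure says nothing
    about the other sets.  Koenig's lemma ([koenig]) writes it as the
    intersection over n of the events that some increasing path of length n
    starts at the root. *)

(** * Simple paths in trees *)

Section SimplePaths.
Context (T : rooted_tree).
Implicit Types (x a b : vertex T) (p q : seq (vertex T)).

(** A path from [a] to [b] avoiding their common neighbour [x] closes up
    through [x]; once its loops are removed this would be a cycle. *)
Lemma neighbours_separated x a b p :
  adj x a -> adj x b -> path adj a p -> last a p = b -> x \notin a :: p ->
  a = b.
Proof.
move=> xa xb ap pb xNp; apply: contrapT => /eqP ab.
case/shortenP: ap pb => q aq uq qp lq.
have sq : (0 < size q)%N by case: q lq {aq uq qp} => //= /eqP; rewrite (negPf ab).
apply: (@tree_acyclic T (x :: a :: q)) => //=; rewrite /ucycle /= xa /=.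
rewrite rcons_path aq lq adj_sym xb /= -/(uniq (a :: q)) uq andbT.
apply: contra xNp; rewrite !inE => /orP[->//|/qp ->].
by rewrite orbT.
Qed.

(** Once the first steps agree, recurse.  They do agree: going along [p] and
    back along [q] joins the two first steps while avoiding [x]. *)
Lemma simple_path_unique x p q : path adj x p -> path adj x q ->
  uniq (x :: p) -> uniq (x :: q) -> last x p = last x q -> p = q.
Proof.
elim: p q x => [|a p IHp] [|b q] x //=.
- by move=> _ _ _ /andP[xbq _] xq; rewrite xq mem_last in xbq.
- by move=> _ _ /andP[xap _] _ xp; rewrite -xp mem_last in xap.
move=> /andP[xa ap] /andP[xb bq] /andP[xNp up] /andP[xNq uq] pq.
have ab : a = b.
  apply: (@neighbours_separated x a b (p ++ rev (belast b q))) => //.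
  - rewrite cat_path ap pq rev_path /=.
    by rewrite (eq_path (e' := adj)) // => u v; rewrite /= adj_sym.
  - rewrite last_cat pq; case: (q) => //= c r.
    by rewrite rev_cons last_rcons.
  - rewrite -cat_cons mem_cat negb_or xNp mem_rev.
    by apply: contra xNq => /mem_belast.
by subst b; congr (_ :: _); apply: IHp pq.
Qed.

(** A shortest walk is a simple path once its loops are removed, so it is this
    one. *)
Lemma gdist_simple_path x p : path adj x p -> uniq (x :: p) ->
  gdist x (last x p) = size p.
Proof.
move=> xp up; rewrite /gdist; case: ex_minnP => n /asboolP[q [xq lq <-]] qmin.
case/shortenP: xq lq qmin => q' xq' uq' qq' lq qmin.
rewrite (simple_path_unique xp xq' up uq' (esym lq)).
apply/eqP; rewrite eqn_leq qmin; last first.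
  by apply/asboolP; exists q'; split=> //; rewrite lq.
by rewrite uniq_leq_size //; case/andP: uq'.
Qed.

Lemma simple_path_exists x y :
  exists p, [/\ path adj x p, uniq (x :: p) & last x p = y].
Proof.
have [p xp lp] := tree_connected x y.
by case/shortenP: xp lp => q xq uq _ lq; exists q.
Qed.

(** Needed to sum probabilities over an arbitrary cutset, which may be
    infinite: there are finitely many walks of each length. *)
Lemma vertex_countable : locally_finite T -> countable [set: vertex T].
Proof.
move=> Tfin.
have walk_fin n : finite_set [set v : vertex T | is_walk_length Defs.root v n].
  elim: n => [|n IHn].
    apply: (@sub_finite_set _ _ [set @Defs.root T]) => [v [p [_ <-]]|] /=.
      by case: p.
    exact: finite_set1.
  have := bigcup_finite IHn (fun u _ => Tfin u); apply: sub_finite_set.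
  move=> v [p [rp <- sp]]; case/lastP: p rp sp => // p u.
  rewrite rcons_path last_rcons size_rcons => /andP[rp pu] [sp].
  by exists (last Defs.root p) => //; exists p.
apply: (sub_countable _ (bigcup_countable (@countableP nat setT)
  (fun n _ => finite_set_countable (walk_fin n)))).
apply: subset_card_le => v _.
have [p rp pv] := tree_connected Defs.root v.
by exists (size p) => //; exists p.
Qed.

Lemma gdist_le_walk x p : path adj x p -> (gdist x (last x p) <= size p)%N.
Proof.
move=> xp; rewrite /gdist; case: ex_minnP => n _; apply.
by apply/asboolP; exists p.
Qed.

End SimplePaths.

Lemma path_mkseq (V : Type) (e : rel V) (f : nat -> V) n :
  (forall k, e (f k) (f k.+1)) ->
  path e (f 0%N) (mkseq (f \o succn) n) /\
  last (f 0%N) (mkseq (f \o succn) n) = f n.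
Proof.
move=> fe; elim: n => [//|n [IHp IHl]].
by rewrite mkseqS rcons_path last_rcons IHp IHl /= fe.
Qed.

(** * Koenig's lemma *)

Section Koenig.
Context (V : choiceType) (e : V -> V -> Prop).

Fixpoint has_chain n x : Prop :=
  if n is m.+1 then exists2 y, e x y & has_chain m y else True.

Lemma has_chain_leq m n x : (m <= n)%N -> has_chain n x -> has_chain m x.
Proof.
elim: m n x => [|m IHm] [|n] x //= mn [y xy yn].
by exists y => //; apply: IHm yn.
Qed.

Lemma chain_has_chain (f : nat -> V) :
  (forall n, e (f n) (f n.+1)) -> forall n, has_chain n (f 0%N).
Proof.
move=> fe n; suff: forall k, has_chain n (f k) by apply.
by elim: n => [//|n IHn] k /=; exists (f k.+1).
Qed.

(** If [y] starts chains of every length then so does one of its successors: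
    otherwise each successor has a bound on the length of its chains, and the
    maximum of these finitely many bounds contradicts the choice of [y]. *)
Lemma koenig x : (forall y, finite_set [set z | e y z]) ->
  (forall n, has_chain n x) ->
  exists2 f : nat -> V, f 0%N = x & forall n, e (f n) (f n.+1).
Proof.
move=> efin xinf; pose inf y := forall n, has_chain n y.
have step y : exists z, inf y -> e y z /\ inf z.
  have [yinf|?] := pselect (inf y); last by exists x.
  apply: contrapT => none.
  have dead z : exists n, e y z -> ~ has_chain n z.
    have [yz|nyz] := pselect (e y z); last by exists 0%N.
    have /existsNP[n zn] : ~ inf z by move=> zinf; apply: none; exists z.
    by exists n.
  have [len lenP] := choice dead.
  have /= [z yz zn] := yinf (\max_(z <- fset_set [set z | e y z]) len z).+1.
  apply: (lenP z yz); apply: has_chain_leq zn.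
  by apply: leq_bigmax_seq => //; rewrite in_fset_set ?inE.
have [next nextP] := choice step.
have iter_inf n : inf (iter n next x).
  by elim: n => [|n /nextP[]].
by exists (fun n => iter n next x) => // n; case: (nextP _ (iter_inf n)).
Qed.

End Koenig.

(** * Measurable events and countable subadditivity *)

Section Events.
Context (R : realType) (d : measure_display) (Omega : measurableType d).

Lemma measurable_lt_event (f g : Omega -> R) :
  measurable_fun setT f -> measurable_fun setT g ->
  measurable [set w | f w < g w].
Proof.
move=> mf mg; have := measurable_fun_ltr mf mg measurableT
  (I : measurable [set true]).
rewrite setTI; congr measurable; apply/seteqP; split=> w /=; by case: ltP.
Qed.

Lemma measurable_sorted_event (I : Type) (X : I -> Omega -> R) (s : seq I) :
  (forall i, measurable_fun setT (X i)) ->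
  measurable [set w | sorted <%R [seq X i w | i <- s]].
Proof.
have mT : measurable [set _ : Omega | true].
  by rewrite (_ : [set _ | _] = setT) //; apply/seteqP.
move=> mX; case: s => [//|i s] /=.
elim: s i => [//|j s IHs] i /=.
have -> : [set w | (X i w < X j w) && path <%R (X j w) [seq X i w | i <- s]]
    = [set w | X i w < X j w] `&` [set w | path <%R (X j w) [seq X i w | i <- s]].
  by apply/seteqP; split=> w /=; [move/andP | move=> ?; apply/andP].
by apply: measurableI; [exact: measurable_lt_event | exact: IHs].
Qed.

(** The set [D y] bounds the possible successors of [y] uniformly in [w], so
    that each step is a finite union of events. *)
Lemma measurable_has_chain (V : choiceType) (E : V -> V -> set Omega)
    (D : V -> set V) n x :
  (forall y, finite_set (D y)) -> (forall y z, measurable (E y z)) ->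
  (forall y z, E y z !=set0 -> D y z) ->
  measurable [set w | has_chain (fun y z => E y z w) n x].
Proof.
move=> Dfin mE ED; elim: n x => [|n IHn] x /=; first exact: measurableT.
have -> : [set w | exists2 y, E x y w & has_chain (fun y z => E y z w) n y] =
    \bigcup_(y in D x)
      (E x y `&` [set w | has_chain (fun y z => E y z w) n y]).
  apply/seteqP; split=> w /=; last by case=> y _ [? ?]; exists y.
  by case=> y xy yn; exists y => //; apply: ED; exists w.
by apply: fin_bigcup_measurable => // y _; apply: measurableI.
Qed.

(** Countable subadditivity for a countable index set that comes without an
    enumeration. *)
Lemma measure_le_esum (mu : {measure set Omega -> \bar R}) (I : choiceType)
    (D : set I) (A : set Omega) (B : I -> set Omega) :
  countable D -> (forall i, measurable (B i)) -> measurable A ->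
  A `<=` \bigcup_(i in D) B i ->
  (mu A <= \esum_(i in D) mu (B i))%E.
Proof.
have [->|/set0P[r _]] := eqVneq D set0.
  move=> _ _ mA; rewrite bigcup_set0 subset0 => ->.
  by rewrite measure0 esum_set0.
move=> /countable_injP[f finj] mB mA AB.
pose g := 'pinv_(cst r) D f.
have gK i : D i -> g (f i) = i by move=> Di; rewrite /g pinvKV ?inE.
pose F n := if n \in f @` D then B (g n) else set0.
have mF n : measurable (F n) by rewrite /F; case: ifP => // _; exact: measurable0.
have AF : A `<=` \bigcup_n F n.
  move=> w /AB[i Di Bi]; exists (f i) => //.
  by rewrite /F gK // ifT // inE; exists i.
have /le_trans := measure_sigma_subadditive mu mF mA AF; apply.
rewrite nneseries_esumT //.
rewrite [leRHS](_ : _ = \esum_(n in f @` D) mu (B (g n))); last first.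
  rewrite esum_image //; first by apply: eq_esum => i Di; rewrite gK.
rewrite [leRHS]esum_mkcond; apply: le_esum => n _.
by rewrite /F; case: ifP; rewrite ?measure0.
Qed.

End Events.

(** * Cells for uniform variables *)

Lemma uniform_prob_le (R : realType) (A : set R) (a h : R) : measurable A ->
  0 <= h -> A `&` `[0, 1] `<=` `[a, a + h] ->
  (uniform_prob (@ltr01 R) A <= h%:E)%E.
Proof.
move=> mA h0 Aah; rewrite /uniform_prob integral_uniform_pdf.
have -> : (\int[lebesgue_measure]_(x in A `&` `[0%R, 1%R]) (uniform_pdf 0 1 x)%:E
   = \int[lebesgue_measure]_(x in A `&` `[0%R, 1%R]) (cst 1 x))%E.
  apply: eq_integral => x; rewrite inE => -[_ /=]; rewrite in_itv /= => x01.
  by rewrite /uniform_pdf x01 subr0 invr1.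
have mA01 : measurable (A `&` `[0%R, 1%R]) by apply: measurableI.
rewrite integral_cst // mul1e.
apply: (@le_trans _ _ (lebesgue_measure `[a, a + h]%classic)).
  by apply: le_measure; rewrite ?inE.
rewrite lebesgue_measure_itv /= lte_fin.
case: ifP => _; rewrite ?lee_fin //; lra.
Qed.

Section Cells.
Context (R : realType) (h : R) (N : nat).
Context (h0 : 0 < h).

(** Cell j is the half-open interval from j * h to (j + 1) * h, except that the
    index is clamped to 0, ..., N.  Clamping makes the outer cells unbounded, so
    the cells cover the whole line and no null set has to be set aside for
    uniform variables taking values outside [0, 1]. *)
Definition cell (x : R) : 'I_N.+1 := inord (minn N (Num.truncn (x / h))).

Lemma cellE x : cell x = minn N (Num.truncn (x / h)) :> nat.
Proof. by rewrite inordK // ltnS geq_minl. Qed.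

Lemma cell_homo x y : x <= y -> (cell x <= cell y)%N.
Proof.
move=> xy; rewrite !cellE leq_min geq_minl /=.
by rewrite (leq_trans (geq_minr _ _)) // le_truncn // ler_pM2r ?invr_gt0.
Qed.

(** By monotonicity the cells are intervals. *)
Lemma measurable_cell_shift (j : 'I_N.+1) (c : R) :
  measurable [set u | cell (u + c) = j].
Proof.
apply: is_interval_measurable => x y /= xj yj z /andP[xz zy].
apply/val_inj/eqP; rewrite /= eqn_leq; apply/andP; split; [rewrite -yj|rewrite -xj].
all: by rewrite cell_homo // lerD2r.
Qed.

(** The shifted unit interval lies between 0 and h * (N + 1), where clamping
    enlarges the last cell only by its right end point. *)
Lemma cell_shift_sub (j : 'I_N.+1) (c : R) : 0 <= c -> 1 + c <= h * N.+1%:R ->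
  [set u | cell (u + c) = j] `&` `[0, 1]
    `<=` `[j%:R * h - c, j%:R * h - c + h].
Proof.
move=> c0 cN u [/= <-]; rewrite /= !in_itv /= cellE => /andP[u0 u1].
have uc0 : 0 <= (u + c) / h by rewrite divr_ge0 ?addr_ge0 // ltW.
have /andP[lo hi] := truncn_itv uc0.
rewrite ler_pdivlMr // in lo; rewrite ltr_pdivrMr // in hi.
have [tN|Nt] := leqP N (Num.truncn ((u + c) / h)).
  have : N%:R * h <= (Num.truncn ((u + c) / h))%:R * h.
    by rewrite ler_pM2r // ler_nat.
  rewrite -[N.+1]addn1 natrD mulrDr in cN.
  by move=> Nth; apply/andP; split; nra.
by rewrite -[_.+1]addn1 natrD in hi; apply/andP; split; nra.
Qed.

Lemma uniform_prob_cell_shift (j : 'I_N.+1) (c : R) :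
  0 <= c -> 1 + c <= h * N.+1%:R ->
  (uniform_prob (@ltr01 R) [set u | cell (u + c)%R = j] <= h%:E)%E.
Proof.
move=> c0 cN; apply: uniform_prob_le (cell_shift_sub c0 cN).
- exact: measurable_cell_shift.
- exact: ltW.
Qed.

End Cells.

(** * Factorial estimates *)

Lemma bin_mul_fact_le (m n : nat) : ('C(n, m) * m`! <= n ^ m)%N.
Proof.
rewrite bin_ffact; elim: m n => [|m IHm] [|n] //.
rewrite ffactSS expnS leq_mul // (leq_trans (IHm n)) //.
by case: (m) => // k; rewrite leq_exp2r.
Qed.

Lemma expR_ge_term (R : realType) (x : R) (m : nat) :
  0 <= x -> x ^+ m / m`!%:R <= expR x.
Proof.
move=> x0; case: m => [|m]; first by rewrite expr0 divr1 -expR0 ler_expR.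
by apply: le_trans (expR_ge1Dxn m x0); rewrite lerDr ler01.
Qed.

(** * Increasing sequences of independent uniform variables *)

Section IncreasingUniforms.
Context (R : realType) (d : measure_display) (Omega : measurableType d).
Context (P : probability Omega R) (I : choiceType) (U : I -> {RV P >-> R}).
Context (U_iid : iid_uniform01 U).

Lemma prob_box_le (s : seq I) (A : I -> set R) (h : R) : uniq s ->
  0 <= h -> (forall i, measurable (A i)) ->
  (forall i, i \in s -> (uniform_prob (@ltr01 R) (A i) <= h%:E)%E) ->
  (P (\bigcap_(i in [set` s]) (U i @^-1` A i)) <= (h ^+ size s)%:E)%E.
Proof.
move=> us h0 mA Ah; have [U_unif U_ind] := U_iid.
pose F : {fset I} := [fset i in s]%fset.
have Fs : perm_eq F s.
  by apply: uniq_perm => // i; rewrite !inE.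
have -> : [set` s] = [set` F] by apply/seteqP; split=> i /=; rewrite !inE.
rewrite U_ind // (perm_big _ Fs) /=.
have {}Ah i : i \in s -> (P (U i @^-1` A i) <= h%:E)%E.
  by move=> /Ah; rewrite -(U_unif i).
elim: s {us F Fs} Ah => [|i s IHs] Ah /=; first by rewrite big_nil.
rewrite big_cons exprS EFinM; apply: lee_pmul => //.
- by apply: prode_ge0.
- by apply: Ah; rewrite mem_head.
- by apply: IHs => j js; apply: Ah; rewrite inE js orbT.
Qed.

Lemma measurable_increasing (s : seq I) (c : I -> R) :
  measurable [set w | sorted <%R [seq (U i w + c i)%R | i <- s]].
Proof.
apply: (measurable_sorted_event (X := fun i w => U i w + c i)) => i.
exact: measurable_funD.
Qed.

(** Stars and bars: the cells of an increasing sequence of labels form one of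
    the 'C(m + N, m) weakly increasing sequences with values in 0, ..., N. *)
Lemma prob_increasing_le_cells (s : seq I) (c : I -> R) (L : R) (N : nat) :
  uniq s -> 0 < L -> (forall i, i \in s -> 0 <= c i /\ 1 + c i <= L) ->
  (P [set w | sorted <%R [seq (U i w + c i)%R | i <- s]] <=
    ('C(size s + N, size s)%:R * (L / N.+1%:R) ^+ size s)%:E)%E.
Proof.
move=> us L0 cL; set m := size s; set h := L / N.+1%:R.
have h0 : 0 < h by rewrite divr_gt0.
have hN : h * N.+1%:R = L by rewrite divfK // pnatr_eq0.
pose box (t : m.-tuple 'I_N.+1) i :=
  [set u : R | cell h N (u + c i) = nth ord0 t (index i s)].
pose G t := \bigcap_(i in [set` s]) (U i @^-1` box t i).
pose D := [set t : m.-tuple 'I_N.+1 | sorted leq (map val t)]%SET.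
have Gle t : (P (G t) <= (h ^+ m)%:E)%E.
  apply: prob_box_le => //; first exact: ltW.
    by move=> i; exact: measurable_cell_shift.
  by move=> i /cL[c0 c1]; apply: uniform_prob_cell_shift => //; rewrite hN.
have cover : [set w | sorted <%R [seq (U i w + c i)%R | i <- s]] `<=`
    \bigcup_(t in [set` enum D]) G t.
  move=> w /= ws.
  exists (map_tuple (fun i => cell h N (U i w + c i)) (in_tuple s)).
    rewrite /= mem_enum inE -map_comp; move: ws; rewrite !sorted_map.
    by apply: sub_sorted => i j /= /ltW; exact: cell_homo.
  by move=> i /= si; rewrite /box /= (nth_map i) ?index_mem ?nth_index.
have mG t : measurable (G t).
  apply: fin_bigcap_measurable => // i _.
  rewrite -[X in measurable X]setTI; apply: measurable_funP => //.
  exact: measurable_cell_shift.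
have /le_trans := content_sub_fsum P (finite_seq (enum D)) (fun t _ => mG t)
  (measurable_increasing s c) cover.
apply; rewrite -fsbig_seq ?enum_uniq // big_enum /=.
apply: (@le_trans _ _ (\sum_(t in D) (h ^+ m)%:E)%E); first exact: lee_sum.
by rewrite sumEFin sumr_const card_sorted_tuples mulr_natl.
Qed.

(** The bound is the volume of the simplex of increasing sequences in [0, L];
    it is the limit of the bound by cells. *)
Lemma prob_increasing_le (s : seq I) (c : I -> R) (L : R) :
  uniq s -> 0 < L -> (forall i, i \in s -> 0 <= c i /\ 1 + c i <= L) ->
  (P [set w | sorted <%R [seq (U i w + c i)%R | i <- s]] <=
    (L ^+ size s / (size s)`!%:R)%:E)%E.
Proof.
move=> us L0 cL; set E := [set w | _].
have PE : P E \is a fin_num.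
  by apply: fin_num_measure; exact: measurable_increasing.
have p0 : 0 <= fine (P E) by rewrite fine_ge0.
have p1 : fine (P E) <= 1.
  by rewrite -lee_fin fineK // probability_le1 //; exact: measurable_increasing.
rewrite -(fineK PE) lee_fin; set m := size s; set K := _ / _.
have K0 : 0 <= K by rewrite divr_ge0 ?exprn_ge0 // ltW.
apply/ler_addgt0Pr => e e0.
(* With N + 1 cells the excess over the limit is at most exp (m^2 / (N + 1)):
   take N so that this exponent is below [e]. *)
pose N := Num.truncn ((m ^ 2)%:R / e).
have Ne : (m ^ 2)%:R / N.+1%:R < e.
  by rewrite ltr_pdivrMr // mulrC -ltr_pdivrMr // truncnS_gt.
set y := (m ^ 2)%:R / N.+1%:R in Ne.
have y0 : 0 <= y by rewrite divr_ge0.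
have pK : fine (P E) <= K * expR y.
  have := prob_increasing_le_cells N us L0 cL.
  rewrite -/E -(fineK PE) lee_fin => /le_trans; apply.
  have mf0 : (0 : R) < m`!%:R by rewrite ltr0n fact_gt0.
  have binle : 'C(m + N, m)%:R * m`!%:R <= ((m + N)%:R : R) ^+ m.
    by rewrite -natrM -natrX ler_nat bin_mul_fact_le.
  have ratio : ((m + N)%:R / N.+1%:R) ^+ m <= expR y.
    have -> : y = m%:R / N.+1%:R * m%:R by rewrite /y natrX expr2 mulrAC.
    rewrite expRM_natr.
    apply: lerXn2r; rewrite ?nnegrE ?divr_ge0 ?expR_ge0 //.
    apply: le_trans (expR_ge1Dx _).
    rewrite ler_pdivrMr // mulrDl divfK ?pnatr_eq0 // mul1r -natrD ler_nat.
    by lia.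
  rewrite -/m; have -> : 'C(m + N, m)%:R * (L / N.+1%:R) ^+ m =
    ('C(m + N, m)%:R * m`!%:R) * K / N.+1%:R ^+ m.
    rewrite /K exprMn exprVn; field.
    by rewrite (gt_eqF mf0) andbT expf_neq0 // pnatr_eq0.
  rewrite [_ * K]mulrC -[K * _ / _]mulrA ler_wpM2l //; apply: le_trans ratio.
  by rewrite expr_div_n ler_wpM2r // invr_ge0 exprn_ge0.
(* As the probability is at most 1, moving the factor exp y to the other side
   as 1 - y costs at most y. *)
have : fine (P E) * (1 - y) <= K.
  have [y1|y1] := leP (1 - y) 0.
    by apply: le_trans K0; rewrite mulr_ge0_le0.
  have ey : 1 - y <= (expR y)^-1 by rewrite -expRN expR_ge1Dx.
  apply: (@le_trans _ _ (K * expR y * (expR y)^-1)); last first.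
    by rewrite mulfK // gt_eqF ?expR_gt0.
  by apply: ler_pM => //; apply: ltW.
by nra.
Qed.

(** The simplex has side 1 + theta * m = theta * x with x = m + 1 / theta, and
    x^m / m! is a term of the series of exp x. *)
Lemma prob_increasing_le_exp (s : seq I) (c : I -> R) (theta : R) :
  uniq s -> 0 < theta ->
  (forall i, i \in s -> 0 <= c i /\ c i <= theta * (size s)%:R) ->
  (P [set w | sorted <%R [seq (U i w + c i)%R | i <- s]] <=
    (expR theta^-1 * (expR 1 * theta) ^+ size s)%:E)%E.
Proof.
move=> us t0 cs; set m := size s; pose x : R := m%:R + theta^-1.
have x0 : 0 < x by rewrite ltr_wpDl ?invr_gt0.
have xE : theta * x = 1 + theta * m%:R.
  by rewrite mulrDr divff ?gt_eqF // addrC.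
apply: (le_trans (@prob_increasing_le s c (theta * x) us _ _)).
- by rewrite mulr_gt0.
- by move=> i /cs[c0 ct]; rewrite xE lerD2l.
rewrite -/m lee_fin exprMn -mulrA.
apply: (@le_trans _ _ (theta ^+ m * expR x)).
  by rewrite ler_wpM2l ?exprn_ge0 ?expR_ge_term // ltW.
rewrite /x expRD exprMn -[m%:R]mulr1 expRM_natl.
by rewrite le_eqVlt; apply/orP; left; apply/eqP; ring.
Qed.

End IncreasingUniforms.

(** * Increasing paths from the root *)

Section Rays.
Context (R : realType) (d : measure_display) (Omega : measurableType d).
Context (P : probability Omega R) (T : rooted_tree).
Context (U : vertex T -> {RV P >-> R}) (theta : R).
Context (Tfin : locally_finite T) (U_iid : iid_uniform01 U).
Context (theta0 : 0 <= theta).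

Local Notation X := (rmf_label U theta).

Definition increasing_along (s : seq (vertex T)) : set Omega :=
  [set w | sorted <%R [seq X v w | v <- s]].

Lemma measurable_rmf_label v : measurable_fun setT (X v).
Proof. exact: measurable_funD. Qed.

(** Strictly increasing labels force an infinite walk to be injective, so only
    adjacency and the labels have to be recorded in the chains. *)
Lemma measurable_increasing_path_event :
  measurable (increasing_path_event U theta).
Proof.
pose E u v := [set w | adj u v /\ X u w < X v w].
have -> : increasing_path_event U theta = \bigcap_n
    [set w | has_chain (fun u v => E u v w) n Defs.root].
  apply/seteqP; split=> w.
    case=> f [[f0 fadj _] finc] n _ /=; rewrite -f0.
    by apply: chain_has_chain => k; split.
  move=> wn; have [u|n|f f0 fE] := @koenig _ (fun u v => E u v w) Defs.root.
  - by apply: sub_finite_set (Tfin u) => v [].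
  - exact: wn.
  have finc k : X (f k) w < X (f k.+1) w by case: (fE k).
  exists f; split => //; split=> // [n|m n fmn]; first by case: (fE n).
  have Xf := homo_ltn lt_trans finc.
  by case: (ltngtP m n) => // /Xf; rewrite fmn ltxx.
apply: bigcapT_measurable => n.
apply: (measurable_has_chain (D := fun u => [set v | adj u v])) => //.
- move=> u v; have [uv|nuv] := boolP (adj u v).
    rewrite (_ : E u v = [set w | X u w < X v w]).
      by apply: measurable_lt_event; exact: measurable_rmf_label.
    by apply/seteqP; split=> w; [case|].
  rewrite (_ : E u v = set0); first exact: measurable0.
  by apply/seteqP; split=> w //; case; rewrite (negPf nuv).
- by move=> u v [w []].
Qed.

(** Bounding with any slope [theta'] above [theta] allows [theta = 0], where
    1 / [theta] would make no sense. *)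
Lemma prob_increasing_along_le (theta' : R) (p : seq (vertex T)) :
  0 < theta' -> theta <= theta' ->
  path adj Defs.root p -> uniq (Defs.root :: p) ->
  (P (increasing_along (Defs.root :: p)) <=
   (expR theta'^-1 * (expR 1 * theta') ^+ (size p).+1)%:E)%E.
Proof.
move=> t0 tt rp up.
apply: (prob_increasing_le_exp U_iid (c := fun v => theta * (gdist Defs.root v)%:R)
  up t0) => v vp; split; first exact: mulr_ge0.
apply: ler_pM => //; rewrite ler_nat /=.
move: vp; rewrite inE => /orP[/eqP->|vp].
  by have := @gdist_le_walk T Defs.root [::] isT; rewrite leqn0 => /eqP ->.
case/splitPr: vp rp {up} => p1 p2; rewrite -cat_rcons cat_path => /andP[rp1 _].
have := gdist_le_walk rp1; rewrite last_rcons => /leq_trans; apply.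
by rewrite size_cat; apply: leqW; apply: leq_addr.
Qed.

(** Union bound over the vertices where an infinite increasing path can meet
    the cutset. *)
Lemma prob_increasing_path_le_cutset (theta' : R) (Pi : set (vertex T)) :
  0 < theta' -> theta <= theta' -> cutset Pi ->
  (P (increasing_path_event U theta) <=
   (expR theta'^-1 * (expR 1 * theta'))%:E *
     cutset_sum (expR 1 * theta')^-1 Pi)%E.
Proof.
move=> t0 tt [_ Picut]; set K := _ * (_ * _); set b := expR 1 * theta'.
have b0 : 0 < b by rewrite mulr_gt0 ?expR_gt0.
have K0 : 0 < K by rewrite mulr_gt0 ?expR_gt0.
have [g gP] := choice (@simple_path_exists T Defs.root).
pose A v := increasing_along (Defs.root :: g v).
have mA v : measurable (A v).
  by apply: measurable_sorted_event => u; exact: measurable_rmf_label.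
have cover : increasing_path_event U theta `<=` \bigcup_(v in Pi) A v.
  move=> w [f [finf finc]]; have [n Pin] := Picut f finf.
  exists (f n) => //; have [f0 fadj finj] := finf.
  have [fp fl] := path_mkseq n fadj.
  have [gp gu gl] := gP (f n).
  have uf : uniq (f 0%N :: mkseq (f \o succn) n).
    have -> : f 0%N :: mkseq (f \o succn) n = mkseq f n.+1.
      by rewrite /mkseq /= (iotaDl 1 0) -map_comp.
    by rewrite map_inj_uniq ?iota_uniq.
  (* The chosen simple path to [f n] is the initial segment of [f]. *)
  have -> : A (f n) = increasing_along (f 0%N :: mkseq (f \o succn) n).
    rewrite /A (_ : g (f n) = mkseq (f \o succn) n) ?f0 //.
    by apply: simple_path_unique gp _ gu _ _; rewrite ?gl -f0 ?fl.
  rewrite /increasing_along /mkset sorted_map /=.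
  by have [] := path_mkseq (e := fun u v => X u w < X v w) n finc.
have cPi : countable Pi := sub_countable (subset_card_le (@subsetT _ Pi))
  (vertex_countable Tfin).
have /le_trans := measure_le_esum P cPi mA measurable_increasing_path_event cover.
apply; apply: ge_ereal_sup => _ [F [Ffin FPi] <-].
apply: (@le_trans _ _ (K%:E * \sum_(v \in F) (b^-1 ^- gdist Defs.root v)%:E)%E);
  last first.
  rewrite lee_pmul2l ?lte_fin //; apply: ereal_sup_ubound.
  by exists F.
rewrite !fsbig_finite // ge0_sume_distrr => [|v _]; last first.
  by rewrite lee_fin invr_ge0 exprn_ge0 ?invr_ge0 ?ltW.
apply: lee_sum => v _; have [gp gu gl] := gP v.
apply: (le_trans (prob_increasing_along_le t0 tt gp gu)).
rewrite -{2}gl (gdist_simple_path gp gu) -EFinM lee_fin exprVn invrK.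
by rewrite exprS mulrA.
Qed.

End Rays.

(** The strict inequality leaves room for a positive slope.  If [b] is infinite
    the hypothesis is contradictory, as its right-hand side is then 0 or -oo;
    if [b <= 0] every positive slope works. *)
Lemma slope_above_branching_number (R : realType) (b : \bar R) (theta : R) :
  0 <= theta -> (theta%:E < ((expR 1)%:E * b)^-1)%E ->
  exists theta' : R, [/\ 0 < theta', theta <= theta' &
    (b < ((expR 1 * theta')^-1)%:E)%E].
Proof.
move=> t0; have e0 := expR_gt0 (1 : R).
case: b => [b| |]; last 2 first.
- by rewrite gt0_muley ?(invey, lte_fin) // ltNge t0.
- by rewrite gt0_muleNy ?(inveNy, lte_fin).
rewrite -EFinM inver; have [b0 _|b0 tb] := leP b 0.
  exists (theta + 1); split; rewrite ?ltr_wpDl ?lerDl // lte_fin.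
  by apply: le_lt_trans b0 _; rewrite invr_gt0 mulr_gt0 ?ltr_wpDl.
rewrite gt_eqF ?mulr_gt0 // lte_fin in tb.
exists ((theta + (expR 1 * b)^-1) / 2); split; [lra|lra|].
have h0 : 0 < (theta + (expR 1 * b)^-1) / 2 by lra.
have bE : b = (expR 1 * (expR 1 * b)^-1)^-1.
  by rewrite invfM invrK mulKf // gt_eqF.
have q0 : 0 < (expR 1 * b)^-1 by rewrite invr_gt0 mulr_gt0.
rewrite lte_fin [ltLHS]bE ltf_pV2 ?posrE; last 2 first.
- exact: mulr_gt0.
- exact: mulr_gt0.
by rewrite ltr_pM2l //; lra.
Qed.

(* The inverse below is the one of \bar R, for which +oo^-1 = 0. *)
Theorem theorem1p6 (R : realType) (d : measure_display)
    (Omega : measurableType d) (P : probability Omega R)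
    (T : rooted_tree) (U : vertex T -> {RV P >-> R})
    (T_infinite : infinite_set [set: vertex T])
    (T_locally_finite : locally_finite T)
    (U_iid : iid_uniform01 U) :
  (forall theta : R, 0 <= theta <= 1 ->
     (theta%:E < ((expR 1)%:E * branching_number R T)^-1)%E ->
     P (increasing_path_event U theta) = 0%E) /\
  (((expR 1)%:E * branching_number R T)^-1 <= theta_c U)%E.
Proof.
have subcritical theta : 0 <= theta <= 1 ->
    (theta%:E < ((expR 1)%:E * branching_number R T)^-1)%E ->
    P (increasing_path_event U theta) = 0%E.
  move=> /andP[t0 _] tbr.
  have [theta' [t'0 tt' brl]] := slope_above_branching_number t0 tbr.
  set l := (expR 1 * theta')^-1 in brl.
  have l0 : 0 < l by rewrite invr_gt0 mulr_gt0 ?expR_gt0.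
  have inf0 : (ereal_inf [set cutset_sum l Pi | Pi in @cutset T] <= 0)%E.
    rewrite leNgt; apply/negP => inf_gt0.
    suff : (l%:E <= branching_number R T)%E by rewrite leNgt brl.
    by apply: ereal_sup_ubound; exists l.
  have K0 : 0 < expR theta'^-1 * (expR 1 * theta').
    by rewrite !mulr_gt0 ?expR_gt0.
  apply/eqP; rewrite eq_le measure_ge0 andbT.
  rewrite -[leRHS](mule0 (expR theta'^-1 * (expR 1 * theta'))%:E).
  rewrite -lee_pdivrMl //; apply: le_trans inf0.
  apply: le_ereal_inf_tmp => _ [Pi Picut <-]; rewrite lee_pdivrMl //.
  exact: prob_increasing_path_le_cutset.
split=> //; apply: le_ereal_inf_tmp => _ [theta [t01 Ppos] <-].
by rewrite leNgt; apply/negP => /(subcritical _ t01) P0; rewrite P0 ltxx in Ppos.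
Qed.
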